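(* Let $K/Z$ be Galois. Write $E:=\{y\in K\mid y+\overline y=1\}$ and, for $e\in E$, let $\mathcal H_e$ be the affine Hermitian variety formed by all points $u+iv$ ($u,v\in K$) of $\mathcal A_K(L)$ subject to the equation $$N(u+iv)=eu+\overline{eu}.$$ Then the non-degenerate circle $$\Gamma_0=\{\,ik_1(k_0+ik_1)^{-1}\mid(0,0)\neq(k_0,k_1)\in K^2\,\}$$ can be written as $$\Gamma_0=\mathcal H_e\cap\mathcal H_f\quad\text{for all }e,f\in E\text{ with }e\neq f.$$
   Context: $L$ is a quaternion skew field (a non-commutative division ring of dimension 4 over its centre) with centre $Z$, and $K$ is a maximal commutative subfield of $L$; so $[K:Z]=2$. When $K/Z$ is Galois, $\overline{(\ )}$ denotes the non-trivial automorphism of $K$ fixing $Z$ elementwise, and $i\in L\setminus K$ is a fixed element with $i^{-1}ui=\overline u$ for all $u\in K$ (so $ui=i\overline u$). Then $i^2\in Z$; write $i^2+\mu_2=0$ with $\mu_2\in Z$. Every element of $L$ is uniquely of the form $u+iv$ with $u,v\in K$. The map $A:L\to L$, $u+iv\mapsto\overline u-iv$ ($u,v\in K$) is an involutory antiautomorphism of $L$, and the norm of $x\in L$ is $N(x):=x^Ax$; thus $N(u+iv)=u\overline u+\mu_2v\overline v$. $\mathcal A_K(L)$ is the affine plane over $K$ on the 2-dimensional right $K$-vector space $L$: its points are the elements of $L$, its lines are the sets $lK+m$ with $l,m\in L$, $l\ne0$. Terminology: chains are the sets $\{(\mathbf p k_0+\mathbf q k_1)L\mid(0,0)\ne(k_0,k_1)\in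 K^2\}$ of one-dimensional right $L$-subspaces of $L^2$, where $\mathbf p,\mathbf q\in L^2$ are linearly independent over $L$. With $\infty:=(0,1)L$ and $\rho:(l_0,l_1)L\mapsto l_1l_0^{-1}$ (for $(l_0,l_1)L\neq\infty$), a non-degenerate circle is a set $\mathcal C^\rho$ where $\mathcal C$ is a chain with $\infty\notin\mathcal C$. The circle $\Gamma_0$ is the one arising from the chain with $\mathbf p=(1,0)$, $\mathbf q=(i,i)$. *)

(* Defs.v *)
From HB Require Import structures.
From mathcomp Require Import all_boot all_order all_fingroup all_algebra all_field.
From mathcomp Require Import boolp classical_sets.

Set Implicit Arguments.
Unset Strict Implicit.
Unset Printing Implicit Defensive.

Import GRing.Theory.

Local Open Scope classical_set_scope.
Local Open Scope ring_scope.

Definition division_ring (L : unitRingType) : Prop :=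
  forall x : L, x != 0 -> x \is a GRing.unit.

(* The ground field [Z] is identified with the centre of [L] through the
   scalars [z%:A]. *)
Definition quaternion_skew_field (Z : fieldType) (L : falgType Z) : Prop :=
  [/\ division_ring L,
      ~ commutative (@GRing.mul L),
      'Z({:L})%VS = 1%VS
    & \dim {:L} = 4].

(* No stability under scaling by a ground field is required: maximality is
   tested against all commutative subfields, not only those containing the
   centre. *)
Definition commutative_subfield (L : unitRingType) (P : {pred L}) : Prop :=
  divring_closed P /\ {in P &, forall x y : L, x * y = y * x}.

Definition maximal_commutative_subfield (L : unitRingType) (P : {pred L}) :
    Prop :=
  commutative_subfield P /\
  forall M : {pred L}, commutative_subfield M ->
    {subset P <= M} -> {subset M <= P}.

(* The commutative subfield of [L] is the image of the field [K] under [iota];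
   the one-dimensional right subspaces of [L^2] are the sets [rline p], [p != 0]. *)
Section Chains.
Variables (Z : fieldType) (K : fieldExtType Z) (L : falgType Z).
Variable iota : 'AHom(K, L).

Definition rscale (p : L * L) (c : L) : L * L := (p.1 * c, p.2 * c).

Definition rline (p : L * L) : set (L * L) := [set rscale p c | c in [set: L]].

Definition rindependent (p q : L * L) : Prop :=
  forall a b : L, rscale p a + rscale q b = 0 -> a = 0 /\ b = 0.

Definition chain (p q : L * L) : set (set (L * L)) :=
  [set rline (rscale p (iota k.1) + rscale q (iota k.2)) |
    k in [set k : K * K | k != (0, 0)]].

Definition infty : set (L * L) := rline (0, 1).

(* The image of a set of points under the partial map
   [(l0, l1)L |-> l1 * l0^-1], which is defined on the points other than
   [infty] and does not depend on the representative [(l0, l1)]. *)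
Definition rho_image (C : set (set (L * L))) : set L :=
  [set l.2 * l.1^-1 |
    l in [set l : L * L | [/\ l != 0, C (rline l) & rline l <> infty]]].

Definition nondegenerate_circle (G : set L) : Prop :=
  exists p q : L * L,
    [/\ rindependent p q, ~ chain p q infty & G = rho_image (chain p q)].

Definition Gamma0 (i : L) : set L := rho_image (chain (1, 0) (i, i)).

End Chains.

Section Norm.
Variables (Z : fieldType) (K : splittingFieldType Z) (L : falgType Z).
Variables (iota : 'AHom(K, L)) (i : L) (bar : gal_of {:K}).

Definition pt (w : K * K) : L := iota w.1 + i * iota w.2.

Fact pt_is_linear : linear pt.
Proof.
by move=> a u v; rewrite /pt /= !linearP /= mulrDr scalerDr -scalerAr addrACA.
Qed.

HB.instance Definition _ := GRing.isLinear.Build Z (K * K)%type L _ pt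
  pt_is_linear.

Definition coords (x : L) : K * K := (linfun pt)^-1%VF x.

(* The map [u + iv |-> bar u - iv], see [antiautE]. *)
Definition antiaut (x : L) : L :=
  iota (bar (coords x).1) - i * iota (coords x).2.

Definition norm (x : L) : L := antiaut x * x.

Definition trace_one : set K := [set y | y + bar y = 1].

Definition hermitian_variety (e : K) : set L :=
  [set x | exists u v : K, x = iota u + i * iota v /\
     norm (iota u + i * iota v) = iota (e * u + bar (e * u))].

Lemma coordsK : division_ring L -> i \notin limg iota -> cancel pt coords.
Proof.
move=> divL iNK w; rewrite /coords -[pt w](lfunE pt).
apply: lker0_lfunK; rewrite -subv0; apply/subvP=> -[u v].
rewrite memv_ker memv0 lfunE /= /pt /= => /eqP uv0.
have v0 : v = 0.
  apply/eqP/negPn/negP=> vn0; case/negP: iNK.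
  suff -> : i = iota (- u / v) by apply: memv_img; apply: memvf.
  have Uv : iota v \is a GRing.unit.
    apply: divL; apply/eqP=> iv0; have := rmorph1 iota.
    by rewrite -(divff vn0) rmorphM /= iv0 mul0r => /eqP; rewrite eq_sym oner_eq0.
  apply: (mulIr Uv); rewrite -rmorphM /= divfK // raddfN /=.
  by apply/eqP; rewrite -addr_eq0 addrC uv0.
apply/eqP; move: uv0; rewrite v0 raddf0 mulr0 addr0 => u0.
congr pair; apply/eqP/negPn/negP=> un0; have := rmorph1 iota.
by rewrite -(divff un0) rmorphM /= u0 mul0r => /eqP; rewrite eq_sym oner_eq0.
Qed.

Lemma antiautE (u v : K) : division_ring L -> i \notin limg iota ->
  antiaut (iota u + i * iota v) = iota (bar u) - i * iota v.
Proof. by move=> divL iNK; rewrite /antiaut (coordsK divL iNK (u, v)). Qed.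

End Norm.

(* Main.v *)
Require Import Defs.
From mathcomp Require Import all_boot all_order all_fingroup all_algebra all_field.
From mathcomp Require Import boolp classical_sets.
From mathcomp Require Import cyclic ring.

(** Since [bar] is non-trivial, [K] has degree at least 2 over [Z]; since
    [(u, v) |-> u + iv] is injective and [L] has dimension 4, that degree is
    exactly 2.  Hence every element of [L] is some [u + iv], [bar] is an
    involution, and [i^2] commutes with [K] and with [i], so that it is a
    central scalar [m] (with [m = - mu_2]).  Products in [L] are then computed
    in [K] by [pt_mul], and the norm of [u + iv] is [u ubar - m v vbar]
    ([norm_pt]).

    Both sides of the last equality turn out to be the set of all [u + iv] such
    that [u = ubar] and [N(u + iv) = u].
    - If [u + iv] lies on the varieties of [e] and [f], then subtracting the two
      equations, and using [e + ebar = f + fbar = 1], gives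
      [(e - f)(u - ubar) = 0], whence [u = ubar]; the common value of the two
      right-hand sides is then [(e + ebar) u = u].  The converse is immediate
      ([Gamma0_hermitian]).
    - If [y = k0 + i k1] is non-zero, then [y^-1 = (k0bar - i k1) / n] with
      [n = N(y)], so that [i k1 y^-1 = u + iv] with [u = - m k1 k1bar / n] and
      [v = k1 k0bar / n], and these satisfy the two equations.  Conversely, for
      a solution with [u != 0], the choice [k1 = 1], [k0 = - m vbar / u] yields
      [(u + iv)(k0 + i k1) = i k1]; if [u = 0], then [v = 0] as well, and the
      point is the origin ([Gamma0_ptP]).

    That [Gamma0] is a non-degenerate circle, and its description by
    parameters, rest on the fact that [k0 + i k1] vanishes for no
    [(k0, k1) != (0, 0)]. *)

Set Implicit Arguments.
Unset Strict Implicit.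
Unset Printing Implicit Defensive.

Import GRing.Theory.

Local Open Scope classical_set_scope.
Local Open Scope ring_scope.

(** * Automorphisms of an extension of degree two *)

Lemma gal_neq1_dim (Z : fieldType) (K : splittingFieldType Z)
    (s : gal_of {:K}) : s != 1%g -> (1 < \dim {:K})%N.
Proof.
move=> s1; rewrite ltn_neqAle adim_gt0 andbT eq_sym; apply: contraNneq s1 => d1.
have E : {:K}%VS = 1%VS.
  by apply/esym/eqP; rewrite eqEdim sub1v d1 dimv1.
apply/gal_eqP=> a _; rewrite gal_id.
have : a \in 1%VS by rewrite -E memvf.
by case/vlineP=> k ->; rewrite linearZ /= rmorph1.
Qed.

Lemma galois_deg2_involutive (Z : fieldType) (K : splittingFieldType Z)
    (s : gal_of {:K}) : galois 1%AS {:K} -> s \in ('Gal({:K} / 1%AS))%g ->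
  \dim {:K} = 2 -> involutive s.
Proof.
move=> gK sG d2 x.
have s2 : (s * s)%g = 1%g.
  by rewrite -expg2 -(expg_cardG sG) -galois_dim //= dimv1 divn1 d2.
by rewrite -galM ?memvf // s2 gal_id.
Qed.

(** * The decomposition [u + iv] *)

Section CircleAsIntersection.

Variables (Z : fieldType) (L : falgType Z) (K : splittingFieldType Z).
Variables (iota : 'AHom(K, L)) (bar : gal_of {:K}) (i : L).
Hypothesis divL : division_ring L.
Hypothesis iNK : i \notin limg iota.
Hypothesis i_conj : forall u : K, i^-1 * iota u * i = iota (bar u).

Local Notation pt := (pt iota i).

Lemma unit_i : i \is a GRing.unit.
Proof. by apply: divL; apply: contraNneq iNK => ->; apply: mem0v. Qed.

Lemma mul_iota_i u : iota u * i = i * iota (bar u).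
Proof. by rewrite -i_conj -mulrA mulVKr ?unit_i. Qed.

Lemma pt_inj : injective pt.
Proof. exact: can_inj (coordsK divL iNK). Qed.

Lemma pt00 : pt (0, 0) = 0.
Proof. by rewrite /pt /= !raddf0 mulr0 addr0. Qed.

Lemma pt_eq0 w : (pt w == 0) = (w == 0).
Proof. by rewrite -(inj_eq pt_inj) linear0. Qed.

Lemma unit_pt w : w != 0 -> pt w \is a GRing.unit.
Proof. by move=> w0; apply: divL; rewrite pt_eq0. Qed.

Lemma dim_limg_pt : \dim (limg (linfun pt)) = (2 * \dim {:K})%N.
Proof.
have k0 : lker (linfun pt) = 0%VS.
  by apply/eqP/lker0P=> x y; rewrite !lfunE; apply: pt_inj.
rewrite (@limg_dim_eq _ _ _ (linfun pt) fullv) ?k0 ?capv0 //.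
by rewrite mul2n -addnn !dimvf.
Qed.

Lemma leq_double_dim : (2 * \dim {:K} <= \dim {:L})%N.
Proof. by rewrite -dim_limg_pt dimvS ?subvf. Qed.

Lemma pt_surj : (\dim {:L} <= 2 * \dim {:K})%N -> forall x, exists w, x = pt w.
Proof.
move=> dimLK x; have : x \in limg (linfun pt).
  suff -> : limg (linfun pt) = fullv by apply: memvf.
  by apply/eqP; rewrite eqEdim subvf dim_limg_pt.
by case/memv_imgP=> w _; rewrite lfunE => ->; exists w.
Qed.

(** * The circle [Gamma0] and its parametrization *)

(** The vector [(1, 0) k0 + (i, i) k1], spanning a point of the chain of
    [Gamma0]. *)
Lemma chain_vectorE (k : K * K) :
  rscale (1, 0) (iota k.1) + rscale (i, i) (iota k.2) =
  (pt k, i * iota k.2).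
Proof. by rewrite /rscale /= mul1r mul0r -[LHS]/(_, _) /= add0r. Qed.

Lemma rline_self (p : L * L) : rline p p.
Proof. by exists 1 => //; rewrite /rscale !mulr1; case: p. Qed.

Lemma rline_neq_infty k a : k != 0 -> rline (pt k, a) <> infty (L := L).
Proof.
move=> k0 E; have := rline_self (pt k, a); rewrite E => -[c _].
rewrite /rscale /= mul0r => -[/esym/eqP].
by rewrite pt_eq0 (negPf k0).
Qed.

Lemma Gamma0_nondegenerate : nondegenerate_circle iota (Gamma0 iota i).
Proof.
exists (1, 0), (i, i); split=> //.
- move=> a b; rewrite /rscale /= mul1r mul0r => -[ab].
  rewrite add0r => ib0; move: ab; rewrite ib0 addr0 => ->; split=> //.
  by apply: (mulrI unit_i); rewrite mulr0.
- by move=> -[k k0]; rewrite chain_vectorE; apply: rline_neq_infty.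
Qed.

Lemma Gamma0_param : Gamma0 iota i =
  [set i * iota k.2 * (iota k.1 + i * iota k.2)^-1 |
    k in [set k : K * K | k != (0, 0)]].
Proof.
rewrite /Gamma0 /rho_image eqEsubset; split=> x /=.
- move=> [l [l0 [k /= k0 kl] linf] <-]; exists k => //=.
  move: (rline_self l); rewrite -kl chain_vectorE => -[c _ lE].
  have c0 : c \is a GRing.unit.
    apply: divL; apply: contraNneq l0 => c0.
    by rewrite -lE /rscale c0 !mulr0.
  by rewrite -lE /rscale /= invrM ?unit_pt // mulrA mulrK.
- move=> [k /= k0 <-]; exists (pt k, i * iota k.2) => //; split.
  + by apply: contraNneq k0 => -[/eqP]; rewrite pt_eq0.
  + by exists k => //; rewrite chain_vectorE.
  + exact: rline_neq_infty.
Qed.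

(** * The norm, and the circle as an intersection of Hermitian varieties *)

Hypothesis barK : involutive bar.
(** The scalar [m] is the square of [i], the [- mu_2] of the equation
    [i^2 + mu_2 = 0]. *)
Variable m : K.
Hypothesis ii : i * i = iota m.
Hypothesis barm : bar m = m.

Lemma m_neq0 : m != 0.
Proof.
apply/eqP=> m0.
by have := unitrMl i unit_i; rewrite ii m0 raddf0 unitr0 unit_i.
Qed.

Lemma pt_mul a b c d :
  pt (a, b) * pt (c, d) = pt (a * c + m * (bar b * d), bar a * d + b * c).
Proof.
rewrite /pt /= !rmorphD !rmorphM /= mulrDl !mulrDr -ii -!mulrA.
rewrite [iota a * (i * _)]mulrA [iota b * (i * _)]mulrA !mul_iota_i -!mulrA.
by rewrite [X in _ + X = _]addrC addrACA.
Qed.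

Lemma norm_pt u v : norm iota i bar (iota u + i * iota v) =
  iota (u * bar u - m * (v * bar v)).
Proof.
rewrite /norm antiautE // -[iota u + _]/(pt (u, v)).
rewrite -mulrN -raddfN -[_ + _]/(pt (bar u, - v)) pt_mul.
rewrite barK mulNr [u * v]mulrC addrN /pt /= raddf0 mulr0 addr0.
by congr (iota _); ring.
Qed.

Lemma hermitian_varietyP e u v :
  hermitian_variety iota i bar e (pt (u, v)) <->
  u * bar u - m * (v * bar v) = e * u + bar e * bar u.
Proof.
split=> [[u' [v' [/(@pt_inj (u, v) (u', v')) [<- <-]]]]|E].
  by rewrite norm_pt rmorphM => /fmorph_inj.
by exists u, v; split=> //; rewrite norm_pt rmorphM E.
Qed.

(** The circle is the locus [u = ubar], [N(u + iv) = u], which does not involve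
    an [e] of trace one. *)
Lemma Gamma0_ptP u v :
  Gamma0 iota i (pt (u, v)) <->
  bar u = u /\ u * bar u - m * (v * bar v) = u.
Proof.
have m0 := m_neq0.
rewrite Gamma0_param; split.
- move=> [[k0 k1] /= kn0].
  set n := k0 * bar k0 - m * (k1 * bar k1).
  (* [k0bar - i k1] is the image of [k0 + i k1] under [antiaut], and [n] is the
     norm of [k0 + i k1]. *)
  have conjE : pt (bar k0, - k1) * pt (k0, k1) = pt (n, 0).
    by rewrite pt_mul barK raddfN /=; congr (pt (_, _)); rewrite /n; ring.
  have n0 : n != 0.
    have U1 : pt (bar k0, - k1) \is a GRing.unit.
      apply: unit_pt; apply: contraNneq kn0 => -[/eqP].
      by rewrite fmorph_eq0 => /eqP-> /eqP; rewrite oppr_eq0 => /eqP->.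
    apply/eqP=> n0; have := unitrMr (pt (k0, k1)) U1.
    by rewrite conjE n0 pt00 unitr0 unit_pt.
  have barn : bar n = n.
    by rewrite /n rmorphB !rmorphM /= !barK barm; ring.
  (* The components of [i k1 (k0bar - i k1) / n]. *)
  pose x := (- m * (k1 * bar k1) / n, k1 * bar k0 / n).
  have xE : pt x * pt (k0, k1) = i * iota k1.
    rewrite pt_mul !rmorphM !fmorphV /= barn rmorphN /= !barK barm.
    rewrite -[RHS]add0r -(raddf0 iota) -[RHS]/(pt (0, k1)).
    by congr (pt (_, _)); rewrite /n; field.
  rewrite -[iota k0 + _]/(pt (k0, k1)) -xE mulrK ?unit_pt // => /pt_inj[<- <-].
  rewrite !rmorphM !fmorphV /= barn rmorphN /= !barK barm; split.
    by ring.
  by rewrite /n; field.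
- move=> [baru Nu].
  case: (eqVneq u 0) => [u0|u0].
    have v0 : v = 0.
      move: Nu; rewrite u0 mul0r sub0r => /eqP; rewrite oppr_eq0 !mulf_eq0.
      by rewrite (negPf m0) fmorph_eq0 orbb => /eqP.
    exists (1, 0) => /=; first by apply/eqP=> -[/eqP]; rewrite oner_eq0.
    by rewrite u0 v0 pt00 /= raddf0 mulr0 mul0r.
  (* With [x = u + iv] and [k1 = 1], the equation [x^-1 = 1 + k0 i^-1] and
     [x^-1 = 1 - i v u^-1] give [k0 = - i v u^-1 i]. *)
  pose k : K * K := (- m * bar v / u, 1).
  have kn0 : k != 0 by apply/eqP=> -[_ /eqP]; rewrite oner_eq0.
  exists k => //; rewrite -[iota k.1 + _]/(pt k).
  apply: (mulIr (unit_pt kn0)); rewrite mulrVK ?unit_pt // pt_mul.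
  rewrite -[LHS]add0r -(raddf0 iota) -[LHS]/(pt (0, 1)).
  congr (pt (_, _)); first by field.
  by rewrite baru; apply: (mulIf u0); rewrite mul1r -{1}Nu baru; field.
Qed.

Lemma Gamma0_hermitian e f : trace_one bar e -> trace_one bar f -> e <> f ->
  (forall x, exists w, x = pt w) ->
  Gamma0 iota i =
    hermitian_variety iota i bar e `&` hermitian_variety iota i bar f.
Proof.
rewrite /trace_one /= => e1 f1 ef surj; rewrite eqEsubset.
split=> x; have [[u v] ->] := surj x.
- move=> /Gamma0_ptP[baru Nu].
  by split; apply/hermitian_varietyP; rewrite Nu baru -mulrDl ?e1 ?f1 mul1r.
- move=> [/hermitian_varietyP He /hermitian_varietyP Hf].
  have baru : bar u = u.
    have : (e - f) * (u - bar u) = 0.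
      have -> : (e - f) * (u - bar u) =
         (e * u + bar e * bar u) - (f * u + bar f * bar u)
         - (e + bar e - (f + bar f)) * bar u by ring.
      by rewrite -He -Hf e1 f1; ring.
    by move/eqP; rewrite mulf_eq0 !subr_eq0 => /orP[/eqP//|/eqP].
  by apply/Gamma0_ptP; split=> //; rewrite He baru -mulrDl e1 mul1r.
Qed.

End CircleAsIntersection.

Theorem theorem5 (Z : fieldType) (L : falgType Z) (K : splittingFieldType Z)
    (iota : 'AHom(K, L)) (bar : gal_of {:K}) (i : L)
    (L_quat : quaternion_skew_field L)
    (K_max : maximal_commutative_subfield [in limg iota])
    (K_galois : galois 1%AS {:K})
    (bar_gal : bar \in ('Gal({:K} / 1%AS))%g)
    (bar_neq1 : bar != 1%g)
    (i_notin_K : i \notin limg iota)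
    (i_conj : forall u : K, i^-1 * iota u * i = iota (bar u)) :
  [/\ nondegenerate_circle iota (Gamma0 iota i),
      Gamma0 iota i =
        [set i * iota k.2 * (iota k.1 + i * iota k.2)^-1 |
          k in [set k : K * K | k != (0, 0)]]
    & forall e f : K, trace_one bar e -> trace_one bar f -> e <> f ->
        Gamma0 iota i =
          hermitian_variety iota i bar e `&` hermitian_variety iota i bar f].
Proof.
case: L_quat => divL _ centL dimL.
have dimK : \dim {:K} = 2.
  apply/eqP; rewrite eqn_leq (gal_neq1_dim bar_neq1) andbT.
  have := leq_double_dim divL i_notin_K.
  by rewrite dimL -[4]/(2 * 2)%N leq_pmul2l.
have barK := galois_deg2_involutive K_galois bar_gal dimK.
have surj : forall x, exists w, x = pt iota i w.
  by apply: pt_surj => //; rewrite dimL dimK.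
have iiZ : i * i \in 'Z({:L})%VS.
  rewrite memv_cap memvf; apply/centvP=> x _; have [[u v] ->] := surj x.
  have ci w : iota w * (i * i) = i * i * iota w.
    by rewrite mulrA (mul_iota_i divL i_notin_K i_conj) -[LHS]mulrA
      (mul_iota_i divL i_notin_K i_conj) barK mulrA.
  by rewrite /pt /= mulrDl mulrDr ci -[i * iota v * _]mulrA ci !mulrA.
move: iiZ; rewrite centL => /vlineP[z iiE].
have ii : i * i = iota z%:A by rewrite linearZ /= rmorph1.
have barz : bar z%:A = z%:A by rewrite linearZ /= rmorph1.
split.
- exact: Gamma0_nondegenerate.
- exact: Gamma0_param.
- by move=> e f e1 f1 ef; apply: (Gamma0_hermitian _ _ _ barK ii barz).
Qed.
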